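(* Let $\Gamma$ be an $n$-player game ($n\ge 2$) with finite nonempty pure strategy sets $S_1,\dots,S_n$ and payoff functions $A_1,\dots,A_n$. Consider the following system of constraints in the variables $x^i_s,r^i_s,u^i_s,\overline{u}^i\in\mathbb{R}$ and $b^i_s\in\{0,1\}$ ($i\in[n]$, $s\in S_i$): $$\sum_{s\in S_i}x^i_s=1\quad\forall i\in[n],$$ and, for all $i\in[n]$ and $s\in S_i$, $$u^i_s=\sum_{\hat{\mathbf{s}}\in S_{-i}}\prod_{s_j\in\hat{\mathbf{s}}}x^j_{s_j}A_i[s,\hat{\mathbf{s}}],\qquad \overline{u}^i\ge u^i_s,\qquad r^i_s=\overline{u}^i-u^i_s,$$ $$x^i_s\le 1-b^i_s,\qquad r^i_s\le U^i b^i_s,\qquad x^i_s\ge 0,\qquad r^i_s\ge 0.$$ The set of feasible solutions of this system is precisely the set of Nash equilibria of $\Gamma$, in the sense that $\mathbf{x}=(x^i_s)_{i\in[n],s\in S_i}$ is a (mixed) Nash equilibrium of $\Gamma$ if and only if there exist values of $r^i_s,u^i_s,\overline{u}^i,b^i_s$ which together with $\mathbf{x}$ satisfy all the constraints.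
   Context: Let $[n]=\{1,\dots,n\}$ be the set of players. Player $i$ has a finite nonempty set $S_i$ of pure strategies. $S_{-i}=S_1\times\dots\times S_{i-1}\times S_{i+1}\times\dots\times S_n$ is the set of pure strategy tuples of all players other than $i$. The payoff function of player $i$ is $A_i:S_1\times\dots\times S_n\to\mathbb{R}$; for $s\in S_i$ and $\hat{\mathbf{s}}\in S_{-i}$, $A_i[s,\hat{\mathbf{s}}]$ is the payoff of player $i$ when $i$ plays $s$ and the others play $\hat{\mathbf{s}}$. For $\hat{\mathbf{s}}=(s_j)_{j\ne i}\in S_{-i}$, the notation $\prod_{s_j\in\hat{\mathbf{s}}}x^j_{s_j}$ means $\prod_{j\ne i}x^j_{s_j}$. The constant $U^i=\max_{s^l,s^h\in S_i,\ \hat{\mathbf{s}}^l,\hat{\mathbf{s}}^h\in S_{-i}}\big(A_i[s^h,\hat{\mathbf{s}}^h]-A_i[s^l,\hat{\mathbf{s}}^l]\big)$ is the maximum difference of any two payoffs of player $i$. A mixed strategy of player $i$ is a vector $\mathbf{x}^i=(x^i_s)_{s\in S_i}$ with $x^i_s\ge 0$ and $\sum_{s\in S_i}x^i_s=1$ (pure strategies are special cases). A mixed strategy profile is a tuple $\mathbf{x}=(\mathbf{x}^1,\dots,\mathbf{x}^n)$ of mixed strategies; player $i$'s expected payoff is $\mathbb{E}[A_i[\mathbf{x}]]=\sum_{s\in S_i}x^i_s\sum_{\hat{\mathbf{s}}\in S_{-i}}A_i[s,\hat{\mathbf{s}}]\prod_{s_j\in\hat{\mathbf{s}}}x^j_{s_j}$.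 A profile $\mathbf{x}$ is a (mixed) Nash equilibrium if for every player $i$ and every mixed strategy $\mathbf{y}^i$ of player $i$, $\mathbb{E}[A_i[\mathbf{x}]]\ge\mathbb{E}[A_i[\mathbf{y}^i,\mathbf{x}^{-i}]]$, where $(\mathbf{y}^i,\mathbf{x}^{-i})$ is $\mathbf{x}$ with $\mathbf{x}^i$ replaced by $\mathbf{y}^i$. *)

(* Defs.v *)
From HB Require Import structures.
From mathcomp Require Import all_boot all_order all_algebra.
From mathcomp Require Import reals.

Set Implicit Arguments.
Unset Strict Implicit.
Unset Printing Implicit Defensive.

Import Order.TTheory GRing.Theory Num.Theory.
Local Open Scope ring_scope.

(* Players are indexed by 'I_n, i.e. from 0 instead of 1. *)

Notation profile S := {dffun forall j, Finite.sort (S j)}.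

Notation opponent i := {j | j != i}.

(* The product of the S j over all j != i. *)
Notation others S i := {dffun forall j : opponent i, Finite.sort (S (val j))}.

Section Game.
Variables (R : realType) (n : nat) (S : 'I_n -> finType).
Variable A : forall i : 'I_n, profile S -> R.

(* The pure profile (s, t) in which i plays s and every j != i plays t j; the
   branch j = i transports s : S i to S j. *)
Definition join i (s : S i) (t : others S i) : profile S :=
  [ffun j => match eq_comparable i j with
             | left eq_ij => ecast k (S k) eq_ij s
             | right ne_ij =>
                 t (exist _ j (introN eqP (fun e => ne_ij (esym e))))
             end].

(* The default value 0 of the iterated maximum is harmless: every S i is
   assumed nonempty, so that 0 is one of the differences. *)
Definition max_payoff_diff i : R :=
  \big[Num.max/0]_(h : S i * others S i) \big[Num.max/0]_(l : S i * others S i)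
     (A i (join h.1 h.2) - A i (join l.1 l.2)).

Definition mixed_strategy i (y : S i -> R) : Prop :=
  (forall s, 0 <= y s) /\ \sum_s y s = 1.

Definition expected_payoff i (x : forall j, S j -> R) : R :=
  \sum_(s : S i) x i s *
    \sum_(t : others S i)
       A i (join s t) * \prod_(j : opponent i) x (val j) (t j).

Definition nash_equilibrium (x : forall j, S j -> R) : Prop :=
  (forall i, mixed_strategy (x i)) /\
  (forall i (y : S i -> R), mixed_strategy y ->
     expected_payoff i (dfwith x y) <= expected_payoff i x).

(* The binary variables are booleans, read in R as 0 or 1. *)
Record feasible (x r u : forall i, S i -> R) (ubar : 'I_n -> R)
    (b : forall i, S i -> bool) : Prop := Feasible {
  feasible_sum : forall i, \sum_(s : S i) x i s = 1;
  feasible_u : forall i (s : S i),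
    u i s = \sum_(t : others S i)
              (\prod_(j : opponent i) x (val j) (t j)) * A i (join s t);
  feasible_ubar : forall i (s : S i), u i s <= ubar i;
  feasible_r : forall i (s : S i), r i s = ubar i - u i s;
  feasible_xb : forall i (s : S i), x i s <= 1 - (b i s)%:R;
  feasible_rb : forall i (s : S i), r i s <= max_payoff_diff i * (b i s)%:R;
  feasible_x_ge0 : forall i (s : S i), 0 <= x i s;
  feasible_r_ge0 : forall i (s : S i), 0 <= r i s
}.

End Game.

(* Main.v *)
Require Import Defs.
From HB Require Import structures.
From mathcomp Require Import all_boot all_order all_algebra.
From mathcomp Require Import reals.

(* The payoff of i under a mixed deviation is the average of the payoffs u i s
   of its pure strategies, so an equilibrium value dominates every u i s and is
   attained on the support of x i. Hence an equilibrium satisfies the system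
   with ubar i the equilibrium payoff and b i s = 1 exactly when x i s = 0, and
   conversely the binary variables force the complementarity x i s * r i s = 0. *)

Set Implicit Arguments.
Unset Strict Implicit.
Unset Printing Implicit Defensive.

Import Order.TTheory GRing.Theory Num.Theory.
Local Open Scope ring_scope.

(** Distributivity of products over sums. An [fprod] is a plain function into the tagged union of
    the [T i], so the dependent case reduces to [bigA_distr_big_dep]. *)
Lemma sum_dffun_prod (R : comPzSemiRingType) (I : finType) (T : I -> finType)
    (F : forall i, T i -> R) :
  \sum_(t : {dffun forall i, T i}) \prod_i F i (t i) = \prod_i \sum_s F i s.
Proof.
rewrite (reindex (@dffun_of_fprod I T)) /=; last first.
  exact/onW_bij/dffun_of_fprod_bij.
pose G i : {ffun T i -> R} := [ffun s => F i s].
transitivity (\sum_(f : fprod T) \prod_(i in I) G i (f i)).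
  by apply: eq_bigr => f _; apply: eq_bigr => i _; rewrite !ffunE.
(* The default [0] of [untag] is never reached, since [j] carries the tag [i]. *)
transitivity (\prod_i \sum_(j in tagged_with T i) untag 0 (G i) j).
  by rewrite big_fprod bigA_distr_big_dep.
apply: eq_bigr => i _; rewrite -(big_tag (fun i => G i)).
by apply: eq_bigr => s _; rewrite ffunE.
Qed.

Section PureStrategyPayoff.
Variables (R : realType) (n : nat) (S : 'I_n -> finType).
Variable A : forall i : 'I_n, profile S -> R.
Implicit Types (x : forall j, S j -> R) (i : 'I_n).

Definition others_prob x i (t : others S i) : R :=
  \prod_(j : opponent i) x (val j) (t j).

Definition pure_payoff x i (s : S i) : R :=
  \sum_(t : others S i) others_prob x t * A i (join s t).

Lemma expected_payoffE x i :
  expected_payoff A i x = \sum_s x i s * pure_payoff x s.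
Proof.
by apply: eq_bigr => s _; congr (_ * _); apply: eq_bigr => t _; rewrite mulrC.
Qed.

(** Only the weights of the opponents [j != i] enter, and the deviation of [i] leaves these
    unchanged. *)
Lemma pure_payoff_dfwith x i (y : S i -> R) (s : S i) :
  pure_payoff (dfwith x y) s = pure_payoff x s.
Proof.
apply: eq_bigr => t _; congr (_ * _); apply: eq_bigr => j _.
by rewrite dfwith_out // eq_sym (valP j).
Qed.

Lemma expected_payoff_dfwith x i (y : S i -> R) :
  expected_payoff A i (dfwith x y) = \sum_s y s * pure_payoff x s.
Proof.
rewrite expected_payoffE dfwith_in.
by apply: eq_bigr => s _; rewrite pure_payoff_dfwith.
Qed.

Lemma mixed_strategy_pure i (s : S i) :
  mixed_strategy (fun s' => (s' == s)%:R : R).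
Proof.
split=> [s'|]; first exact: ler0n.
rewrite (bigD1 s) //= eqxx big1 ?addr0 // => s' /negbTE -> //.
Qed.

Lemma max_payoff_diffP i (h l : S i) (th tl : others S i) :
  A i (join h th) - A i (join l tl) <= max_payoff_diff A i.
Proof.
rewrite /max_payoff_diff.
apply: (bigmax_sup (h, th)) => //.
exact: (bigmax_sup (l, tl)).
Qed.

Lemma sum_others_prob x i :
  (forall j, \sum_s x j s = 1) -> \sum_(t : others S i) others_prob x t = 1.
Proof.
move=> x1; rewrite (sum_dffun_prod (fun j : opponent i => x (val j))).
by apply: big1 => j _.
Qed.

(** Both payoffs are averages over the same distribution of the opponents' play, so their difference
    is an average of differences of entries of [A i]. *)
Lemma pure_payoff_diff_le x i (h l : S i) :
  (forall j, mixed_strategy (x j)) ->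
  pure_payoff x h - pure_payoff x l <= max_payoff_diff A i.
Proof.
move=> xP; rewrite -sumrB -[leRHS]mul1r -(@sum_others_prob x i); last first.
  by move=> j; case: (xP j).
rewrite mulr_suml; apply: ler_sum => t _; rewrite -mulrBr.
apply: ler_wpM2l; last exact: max_payoff_diffP.
by apply: prodr_ge0 => j _; case: (xP (val j)).
Qed.

End PureStrategyPayoff.

Theorem proposition3 (R : realType) (n : nat) (S : 'I_n -> finType)
    (A : forall i : 'I_n, profile S -> R) (x : forall i : 'I_n, S i -> R)
    (n_ge2 : (2 <= n)%N) (S_nonempty : forall i : 'I_n, (0 < #|S i|)%N) :
  nash_equilibrium A x <->
  exists (r u : forall i : 'I_n, S i -> R) (ubar : 'I_n -> R)
         (b : forall i : 'I_n, S i -> bool),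
    feasible A x r u ubar b.
Proof.
split=> [[xP xN]|[r [u [ubar [b [x1 uE u_le rE x_le r_le x0 r0]]]]]].
  pose v i := expected_payoff A i x.
  have x0 i s : 0 <= x i s by case: (xP i).
  have x1 i : \sum_s x i s = 1 by case: (xP i).
  have u_le i (s : S i) : pure_payoff A x s <= v i.
    (* Test the equilibrium against the deviation to the pure strategy [s]. *)
    have := xN i _ (mixed_strategy_pure R s); rewrite expected_payoff_dfwith.
    rewrite (bigD1 s) //= eqxx mul1r big1 ?addr0 // => s' /negbTE ->.
    by rewrite mul0r.
  have sum_x_diff i c : \sum_s x i s * (c - pure_payoff A x s) = c - v i.
    under eq_bigr do rewrite mulrBr.
    by rewrite sumrB -mulr_suml x1 mul1r -expected_payoffE.
  exists (fun i s => v i - pure_payoff A x s), (pure_payoff A x), v,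
    (fun i s => x i s == 0).
  split=> // i s; last by rewrite subr_ge0.
    case: eqP => [->|_]; first by rewrite subrr.
    by rewrite subr0 -(x1 i) (bigD1 s) //= lerDl sumr_ge0.
  case: eqP => [_|/eqP xs_neq0].
    (* Here [b i s = 1]: as [v i] averages the pure payoffs, the regret of [s] is an average of
       their differences. *)
    rewrite mulr1 /v expected_payoffE.
    rewrite -[pure_payoff A x s]mul1r -[max_payoff_diff A i]mul1r -(x1 i).
    rewrite !mulr_suml -sumrB; apply: ler_sum => s' _; rewrite -mulrBr.
    by apply: ler_wpM2l => //; apply: pure_payoff_diff_le.
  (* Here [b i s = 0], so the regret of [s] must vanish: the weighted regrets are nonnegative with
     sum zero, and [x i s] is nonzero. *)
  have x_diff_ge0 s' : true -> 0 <= x i s' * (v i - pure_payoff A x s').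
    by rewrite mulr_ge0 ?subr_ge0.
  have sum0 : \sum_s' x i s' * (v i - pure_payoff A x s') = 0.
    by rewrite sum_x_diff subrr.
  have /eqP := psumr_eq0P x_diff_ge0 sum0 (i := s) isT.
  by rewrite mulf_eq0 (negbTE xs_neq0) /= => /eqP ->; rewrite mulr0.
have uE' i (s : S i) : pure_payoff A x s = u i s by rewrite uE.
split=> [i|i y [y0 y1]]; first by split.
(* By complementarity, [ubar i] and [u i s] agree wherever [x i s] is nonzero, hence on average. *)
have -> : expected_payoff A i x = ubar i.
  rewrite expected_payoffE -[RHS]mul1r -(x1 i) mulr_suml.
  apply: eq_bigr => s _; apply/eqP; rewrite eq_sym -subr_eq0 -mulrBr uE' -rE.
  rewrite mulf_eq0; have := x_le i s; have := r_le i s.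
  case: (b i s); rewrite ?mulr0 ?subrr => r_le0 x_le0; apply/orP.
    by left; rewrite eq_le x_le0 x0.
  by right; rewrite eq_le r_le0 r0.
(* A deviation earns an average of the [u i s], all bounded by [ubar i]. *)
rewrite expected_payoff_dfwith -[leRHS]mul1r -y1 mulr_suml.
by apply: ler_sum => s _; rewrite ler_wpM2l // uE'.
Qed.
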